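(* Let $\alpha\in\mathbf{R}$, $\sigma>0$, let $m_n$ ($n\ge 0$) be the moments of the $(\alpha,\sigma)$-lognormal distribution and let $C$ be its critical ratio. For every $\varepsilon>0$ there exist $b_0>0$ and $N\in\mathbf{N}$ such that for every $b\in(0,b_0)$ the following hold. (1) If $\tilde m_n$ are the moments and $\tilde C$ the critical ratio of the left-truncated $(\alpha,\sigma)$-lognormal distribution with truncation interval $(0,b)$, then $|\tilde m_n-m_n|<\varepsilon$ for all $n\ge N$, and $|\tilde C-C|<\varepsilon$. (2) The same is true for gap-censored lognormal distributions: for every $a\in(0,b)$, if $\tilde m_n$ are the moments and $\tilde C$ the critical ratio of the gap-censored $(\alpha,\sigma)$-lognormal distribution with gap $(a,b)$, then $|\tilde m_n-m_n|<\varepsilon$ for all $n\ge N$, and $|\tilde C-C|<\varepsilon$.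
   Context: The $(\alpha,\sigma)$-lognormal distribution is the probability measure on $\mathbf{R}_+$ with density $\frac{1}{\sqrt{2\pi\sigma^2}\,y}\exp\{-\frac{(\log y-\alpha)^2}{2\sigma^2}\}$, $y>0$. The left-truncated lognormal is constructed by removing the mass over the interval $(0,b)$, $b>0$, and transferring the removed mass to the origin. The gap-censored lognormal is constructed by cutting off the mass over the interval $(a,b)$, $0<a<b$, and transferring that mass to the origin. For a measure on $\mathbf{R}_+$ with all moments $\mu_n$ finite, its critical ratio is $\limsup_{n\to\infty}\frac{\mu_n^2}{\mu_{n-1}\mu_{n+1}}$. *)

(* Defs.v *)
From HB Require Import structures.
From mathcomp Require Import all_boot all_order all_algebra.
From mathcomp Require Import all_classical all_reals all_analysis.
From mathcomp Require Import measurable_realfun.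

Set Implicit Arguments.
Unset Strict Implicit.
Unset Printing Implicit Defensive.

Import Order.TTheory GRing.Theory Num.Theory.
Import numFieldNormedType.Exports.

Local Open Scope classical_set_scope.
Local Open Scope ring_scope.

Section lognormal.
Context {R : realType}.
Implicit Types alpha sigma x y : R.
Local Notation mu := (@lebesgue_measure R).

Definition lognormal_pdf alpha sigma : R -> R :=
  (fun y => (Num.sqrt (2 * pi * sigma ^+ 2) * y)^-1 *
            expR (- (ln y - alpha) ^+ 2 / (2 * sigma ^+ 2))) \_ `]0, +oo[.

Lemma lognormal_pdfE alpha sigma y : 0 < y ->
  lognormal_pdf alpha sigma y = (Num.sqrt (2 * pi * sigma ^+ 2) * y)^-1 *
    expR (- (ln y - alpha) ^+ 2 / (2 * sigma ^+ 2)).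
Proof.
by move=> y0; rewrite /lognormal_pdf patchE ifT// inE/= in_itv/= y0.
Qed.

Lemma lognormal_pdf_ge0 alpha sigma y : 0 <= lognormal_pdf alpha sigma y.
Proof.
apply: restrict_ge0 => {}y /=; rewrite in_itv/= andbT => y0.
by rewrite mulr_ge0 ?expR_ge0// invr_ge0 mulr_ge0 ?sqrtr_ge0// ltW.
Qed.

Lemma measurable_lognormal_pdf alpha sigma :
  measurable_fun [set: R] (lognormal_pdf alpha sigma).
Proof.
apply/measurable_restrict => //; rewrite setTI.
have mV (c : R) : measurable_fun (`]0, +oo[ : set R) (fun y : R => (c * y)^-1).
  rewrite (_ : (fun _ => _) = (fun y : R => c^-1 * y^-1)); last first.
    by apply/funext => y; rewrite invfM.
  apply: measurable_funM => //.
  apply: open_continuous_measurable_fun; first exact: interval_open.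
  move=> y; rewrite inE/= in_itv/= andbT => y0.
  by apply: cvgV => //; rewrite gt_eqF.
apply: measurable_funM; first exact: mV.
apply: measurable_funTS; apply: measurableT_comp => //.
apply: measurable_funM => //; apply: measurableT_comp => //.
apply: measurable_funX; apply: measurable_funB => //; exact: measurable_ln.
Qed.

Lemma lognormal_pdf_normal alpha sigma y : sigma != 0 -> 0 < y ->
  lognormal_pdf alpha sigma y = normal_pdf alpha sigma (ln y) * y^-1.
Proof.
move=> s0 y0; rewrite lognormal_pdfE// normal_pdfE// /normal_peak /normal_fun.
rewrite invfM mulrAC; congr (_^-1 * expR (_ / _) * _).
  by congr Num.sqrt; rewrite -[RHS]mulr_natl -mulrA [pi * _]mulrC.
by rewrite mulr_natl.
Qed.

Definition lognormal_prob alpha sigma : set (measurableTypeR R) -> \bar R :=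
  fun V => (\int[mu]_(y in V) (lognormal_pdf alpha sigma y)%:E)%E.

End lognormal.

Section lognormal_measure.
Context {R : realType}.
Variables alpha sigma : R.
Local Notation mu := (@lebesgue_measure R).
Local Notation lognormal := (lognormal_prob alpha sigma).

Let lognormal0 : lognormal set0 = 0%E.
Proof. by rewrite /lognormal_prob integral_set0. Qed.

Let lognormal_ge0 A : (0 <= lognormal A)%E.
Proof. by apply: integral_ge0 => x _; rewrite lee_fin lognormal_pdf_ge0. Qed.

Let lognormal_sigma_additive : semi_sigma_additive lognormal.
Proof.
move=> /= F mF tF mUF; rewrite /lognormal_prob; apply: cvg_toP.
  apply: ereal_nondecreasing_is_cvgn => m n mn.
  apply: lee_sum_nneg_natr => // k _ _; exact: lognormal_ge0.
rewrite ge0_integral_bigcup//=.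
- apply/measurable_funTS/measurableT_comp => //.
  exact: measurable_lognormal_pdf.
- by move=> x _; rewrite lee_fin lognormal_pdf_ge0.
Qed.

HB.instance Definition _ := isMeasure.Build _ _ _
  lognormal lognormal0 lognormal_ge0 lognormal_sigma_additive.

Let ln_cvgy : ln x @[x --> +oo] --> (+oo : set_system R).
Proof.
apply/cvgryPge => A; near=> x.
have x0 : 0 < x by near: x; exact: nbhs_pinfty_gt.
by rewrite -(expRK A) ler_ln ?posrE ?expR_gt0//.
Unshelve. all: by end_near. Qed.

Let integral_lognormal_pdf_expR (c : R) : sigma != 0 ->
  (\int[mu]_(y in `[expR c, +oo[) (lognormal_pdf alpha sigma y)%:E =
   \int[mu]_(x in `[c, +oo[) (normal_pdf alpha sigma x)%:E)%E.
Proof.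
move=> s0; have ec0 := expR_gt0 c.
have pos (x : R) : x \in `[expR c, +oo[ -> 0 < x.
  by rewrite in_itv/= andbT; exact: lt_le_trans.
have dln (x : R) : 0 < x -> (@ln R)^`()%classic x = x^-1.
  by move=> x0; rewrite derive1E; apply: derive_val; exact: is_derive1_ln.
have cV (x : R) : 0 < x -> (@ln R)^`()%classic y @[y --> x] --> x^-1.
  move=> x0; apply: (@cvg_trans _ (y^-1 @[y --> x])); last first.
    by apply: inv_continuous; rewrite gt_eqF.
  by apply: near_eq_cvg; near=> y; rewrite dln//; near: y; exact: lt_nbhsr.
rewrite -[in RHS](expRK c).
rewrite (@increasing_ge0_integration_by_substitutiony _ (@ln R)).
- apply: eq_integral => y /[!inE]/= yc.
  by rewrite fctE dln ?lognormal_pdf_normal// pos.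
- by move=> x y xc yc xy; rewrite ltr_ln ?posrE ?pos.
- move=> x; rewrite in_itv/= andbT => cx.
  have x0 := lt_trans ec0 cx.
  by rewrite /continuous_at dln//; exact: cV.
- apply/cvg_ex; exists (expR c)^-1.
  by apply: cvg_at_right_filter; exact: cV.
- apply/cvg_ex; exists 0.
  apply: (@cvg_trans _ (y^-1 @[y --> +oo])); last first.
    by apply/gtr0_cvgV0 => //; exact: nbhs_pinfty_gt.
  by apply: near_eq_cvg; near=> y; rewrite dln//; near: y; exact: nbhs_pinfty_gt.
- split; last by apply: cvg_at_right_filter; exact: continuous_ln.
  move=> x; rewrite in_itv/= andbT => cx.
  by apply: ex_derive; apply: is_derive1_ln; exact: lt_trans cx.
- exact: ln_cvgy.
- by apply: continuous_subspaceT; exact: continuous_normal_pdf.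
- by move=> x _; exact: normal_pdf_ge0.
Unshelve. all: by end_near. Qed.

Lemma lognormal_prob_setT : sigma != 0 -> lognormal setT = 1%E.
Proof.
move=> s0; rewrite /lognormal_prob.
pose F n : set (measurableTypeR R) := `[expR (- n%:R), +oo[%classic.
pose G n : set (measurableTypeR R) := `[- n%:R, +oo[%classic.
have UG : \bigcup_n G n = setT.
  rewrite -subTset => x _; exists (Num.truncn `|x|).+1 => //=.
  rewrite /G/= in_itv/= andbT lerNl ltW// (le_lt_trans (ler_norm _))//.
  by rewrite normrN truncnS_gt.
have UF : \bigcup_n F n = `]0, +oo[%classic.
  rewrite eqEsubset; split => [x [n _]|x]; rewrite /F/= !in_itv/= !andbT.
    exact/lt_le_trans/expR_gt0.
  move=> x0; have : setT (ln x) by [].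
  rewrite -UG => -[n _]; rewrite /G/= in_itv/= andbT => nx; exists n => //=.
  by rewrite /F/= in_itv/= andbT -[leRHS]lnK ?posrE// ler_expR.
have ndF : nondecreasing_seq F.
  move=> m n mn; rewrite subsetEset => x; rewrite /F/= !in_itv/= !andbT.
  by apply: le_trans; rewrite ler_expR lerN2 ler_nat.
have ndG : nondecreasing_seq G.
  move=> m n mn; rewrite subsetEset => x; rewrite /G/= !in_itv/= !andbT.
  by apply: le_trans; rewrite lerN2 ler_nat.
have mpdf (D : set (measurableTypeR R)) : measurable_fun D (fun y => (lognormal_pdf alpha sigma y)%:E).
  apply/measurable_funTS/measurableT_comp => //.
  exact: measurable_lognormal_pdf.
transitivity (\int[mu]_(y in `]0%R, +oo[) (lognormal_pdf alpha sigma y)%:E)%E.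
  rewrite [RHS]integral_mkcond; apply: eq_integral => y _.
  by rewrite /lognormal_pdf !patchE; case: ifPn.
rewrite -UF -(integral_normal_pdf alpha sigma) -UG.
have cF : (\int[mu]_(y in F n) (lognormal_pdf alpha sigma y)%:E @[n --> \oo] -->
    \int[mu]_(y in \bigcup_n F n) (lognormal_pdf alpha sigma y)%:E)%E.
  apply: ge0_nondecreasing_set_cvg_integral => //.
  - by move=> n; exact: measurable_itv.
  - by move=> n x _; rewrite lee_fin lognormal_pdf_ge0.
have cG : (\int[mu]_(y in G n) (normal_pdf alpha sigma y)%:E @[n --> \oo] -->
    \int[mu]_(y in \bigcup_n G n) (normal_pdf alpha sigma y)%:E)%E.
  apply: ge0_nondecreasing_set_cvg_integral => //.
  - by move=> n; exact: measurable_itv.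
  - move=> n; apply/measurable_funTS/measurableT_comp => //.
    exact: measurable_normal_pdf.
  - by move=> n x _; rewrite lee_fin normal_pdf_ge0.
apply: cvg_unique cF _ => //.
rewrite (_ : (fun _ => _) =
    (fun n => \int[mu]_(y in G n) (normal_pdf alpha sigma y)%:E)%E)//.
by apply/funext => n; exact: integral_lognormal_pdf_expR.
Qed.

(* For sigma = 0 the density vanishes, as division by 0 yields 0. *)
Let lognormal_setT_le1 : (lognormal setT <= 1)%E.
Proof.
have [s0|s0] := eqVneq sigma 0; last by rewrite lognormal_prob_setT.
rewrite /lognormal_prob integral0_eq// => y _.
rewrite /lognormal_pdf patchE; case: ifPn => // _.
by rewrite s0 expr0n/= mulr0 sqrtr0 mul0r invr0 mul0r.
Qed.

HB.instance Definition _ :=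
  Measure_isSubProbability.Build _ _ _ lognormal lognormal_setT_le1.

End lognormal_measure.

Section transfer.
Context {R : realType}.
Local Open Scope ereal_scope.

Definition mass_to_origin (P : set (measurableTypeR R) -> \bar R)
    (I : set (measurableTypeR R)) : set (measurableTypeR R) -> \bar R :=
  fun V => P (V `\` I) + P I * @dirac _ (measurableTypeR R) (0%R : R) R V.

Definition left_truncated (P : set (measurableTypeR R) -> \bar R) (b : R) :=
  mass_to_origin P `]0%R, b[.

Definition gap_censored (P : set (measurableTypeR R) -> \bar R) (a b : R) :=
  mass_to_origin P `]a, b[.

End transfer.

Section transfer_measure.
Context {R : realType} (P : {finite_measure set (measurableTypeR R) -> \bar R}).
Local Open Scope ereal_scope.

Section itv.
Variable i : interval R.

Let mC : measurable (~` [set` i]).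
Proof. by apply: measurableC; exact: measurable_itv. Qed.

Let mass_ge0 : (0 <= fine (P [set` i]))%R.
Proof. by rewrite fine_ge0. Qed.

Let mass : {measure set (measurableTypeR R) -> \bar R} :=
  measure_add (mrestr P mC)
    (mscale (NngNum mass_ge0) (@dirac _ (measurableTypeR R) (0%R : R) R)).

Let mass_to_originE : mass_to_origin P [set` i] = mass.
Proof.
apply/funext => V; rewrite [RHS]measure_addE/= /mrestr /mscale/= fineK//.
by apply: fin_num_measure; exact: measurable_itv.
Qed.

Let mass0 : mass_to_origin P [set` i] set0 = 0.
Proof. by rewrite mass_to_originE measure0. Qed.

Let mass_nneg A : 0 <= mass_to_origin P [set` i] A.
Proof. by rewrite mass_to_originE. Qed.

Let mass_sigma_additive : semi_sigma_additive (mass_to_origin P [set` i]).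
Proof. by rewrite mass_to_originE; exact: measure_semi_sigma_additive. Qed.

HB.instance Definition _ := isMeasure.Build _ _ _
  (mass_to_origin P [set` i]) mass0 mass_nneg mass_sigma_additive.

End itv.

HB.instance Definition _ b :=
  Measure.copy (left_truncated P b) (mass_to_origin P `]0%R, b[).

HB.instance Definition _ a b :=
  Measure.copy (gap_censored P a b) (mass_to_origin P `]a, b[).

End transfer_measure.

Section moments.
Context {R : realType}.
Implicit Type P : {measure set (measurableTypeR R) -> \bar R}.
Local Open Scope ereal_scope.

(* A measure on the nonnegative half-line is represented by a measure on R
   carried by [0, +oo[. Moments are extended reals, so that their finiteness
   is not presupposed. *)
Definition moment P (n : nat) : \bar R :=
  \int[P]_(y in `[0%R, +oo[) (y ^+ n)%:E.

(* The index is shifted by one, which does not change the limsup and avoids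
   the term n - 1 at n = 0. *)
Definition critical_ratio P : \bar R :=
  limn_esup (fun n => moment P n.+1 ^+ 2 / (moment P n * moment P n.+2)).

End moments.

(* Main.v *)
(* Multiplying the (alpha, sigma)-lognormal density by y^n gives m_n times the
   (alpha + n sigma^2, sigma)-lognormal density, with
   m_n = exp(n alpha + n^2 sigma^2 / 2). Transferring the mass of an interval
   I inside (0, b), b < 1, to the origin therefore turns m_n (n > 0) into
   m_n (1 - e_n), where e_n is the mass of I for the tilted law and
   m_n e_n <= b^n. As m_n >= 1 eventually, e_n tends to 0, so that both
   critical ratios are equal to exp(- sigma^2). *)
Require Import Defs.
From mathcomp Require Import all_boot all_order all_algebra.
From mathcomp Require Import all_classical all_reals all_analysis.
From mathcomp Require Import measurable_realfun ring.
Import Order.TTheory GRing.Theory Num.Theory.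
Import numFieldNormedType.Exports.
Local Open Scope classical_set_scope.
Local Open Scope ring_scope.

(** * Integration against a measure given by a density *)

Section density.
Context d (T : measurableType d) (R : realType).
Variables (nu : {finite_measure set T -> \bar R})
  (mu : {sigma_finite_measure set T -> \bar R}) (p : T -> R).
Hypothesis mp : measurable_fun [set: T] p.
Hypothesis nuE : forall A, measurable A -> (nu A = \int[mu]_(x in A) (p x)%:E)%E.

Let numu : nu `<< mu.
Proof.
apply/null_content_dominatesP => A mA muA0; rewrite nuE//.
by apply: null_set_integral => //; exact/measurable_funTS/measurable_EFinP.
Qed.

(** [p] and the Radon-Nikodym derivative of [nu] have the same integral over every measurable set,
    hence agree almost everywhere, and the change of variables known for the derivative carries over
    to [p]. *)
Lemma ge0_integral_density (D : set T) (f : T -> \bar R) : measurable D ->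
  measurable_fun D f -> (forall x, 0 <= f x)%E ->
  (\int[nu]_(x in D) f x = \int[mu]_(x in D) (f x * (p x)%:E))%E.
Proof.
move=> mD mf f0.
rewrite -(Radon_Nikodym_SigmaFinite.change_of_variables numu)//.
have fint := Radon_Nikodym_SigmaFinite.f_integrable numu.
apply: ae_eq_integral => //.
- apply: emeasurable_funM => //; apply: measurable_funTS.
  exact: measurable_int fint.
- by apply: emeasurable_funM => //; exact/measurable_funTS/measurable_EFinP.
apply: ae_eqe_mul2l; apply: integral_ae_eq => //.
- exact: integrableS fint.
- exact/measurable_funTS/measurable_EFinP.
- by move=> E ED mE; rewrite -Radon_Nikodym_SigmaFinite.f_integral// nuE.
Qed.

End density.

(** * Incomplete moments of the lognormal law by tilting *)

Section lognormal_moments.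
Context {R : realType}.
Variables (alpha sigma : R).
Hypothesis sigma_gt0 : 0 < sigma.
Local Notation P := (lognormal_prob alpha sigma).
Local Notation tilted n := (lognormal_prob (alpha + n%:R * sigma ^+ 2) sigma).

(** This is the moment generating function at [n] of the normal law with mean [alpha] and variance
    [sigma ^+ 2]. *)
Definition lognormal_moment (n : nat) : R :=
  expR (n%:R * alpha + n%:R ^+ 2 * sigma ^+ 2 / 2).
Local Notation M := lognormal_moment.

Lemma lognormal_moment_gt0 n : 0 < M n.
Proof. exact: expR_gt0. Qed.

(* Completing the square in the exponent. *)
Lemma lognormal_pdf_tilt n y : `|y| ^+ n * lognormal_pdf alpha sigma y =
  M n * lognormal_pdf (alpha + n%:R * sigma ^+ 2) sigma y.
Proof.
have [y0|y0] := leP y 0.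
  by rewrite /lognormal_pdf !patchE memNset ?mulr0//= in_itv/= andbT ltNge y0.
rewrite !lognormal_pdfE// gtr0_norm// mulrCA [RHS]mulrCA; congr (_ * _).
rewrite -[y in y ^+ n]lnK ?posrE// -expRM_natl -!expRD; congr expR.
by field; rewrite gt_eqF.
Qed.

Lemma integral_lognormal_expr n (D : set (measurableTypeR R)) :
  measurable D -> D `<=` `[0, +oo[ ->
  (\int[P]_(y in D) (y ^+ n)%:E = (M n)%:E * tilted n D)%E.
Proof.
move=> mD D0.
(* The density lemma asks for an integrand that is nonnegative on the whole line, which [y ^+ n] is
   not for odd [n]. *)
transitivity (\int[P]_(y in D) (`|y| ^+ n)%:E)%E.
  apply: eq_integral => y /[!inE] /D0/=; rewrite in_itv/= andbT => y0.
  by rewrite ger0_norm.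
rewrite (@ge0_integral_density _ _ _ _ lebesgue_measure
  (lognormal_pdf alpha sigma))//.
- transitivity (\int[lebesgue_measure]_(y in D)
      ((M n)%:E * (lognormal_pdf (alpha + n%:R * sigma ^+ 2) sigma y)%:E))%E.
    by apply: eq_integral => y _; rewrite -!EFinM lognormal_pdf_tilt.
  apply: ge0_integralZl => //.
  + apply/measurable_funTS/measurable_EFinP; exact: measurable_lognormal_pdf.
  + by move=> y _; rewrite lee_fin lognormal_pdf_ge0.
  + by rewrite lee_fin ltW// lognormal_moment_gt0.
- exact: measurable_lognormal_pdf.
- apply/measurable_funTS/measurable_EFinP/measurable_funX.
  exact: normr_measurable.
Qed.

Lemma lognormal_prob_pos (D : set (measurableTypeR R)) :
  measurable D -> `]0, +oo[ `<=` D -> P D = 1%E.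
Proof.
move=> mD D0; rewrite -(@lognormal_prob_setT R alpha sigma) ?gt_eqF//.
rewrite -(setUv D) measureU ?setICr//; last exact: measurableC.
rewrite [X in (_ + X)%E](_ : _ = 0%E) ?adde0//.
apply: integral0_eq => y Dy; rewrite /lognormal_pdf patchE memNset//.
by move=> /D0.
Qed.

End lognormal_moments.

(** * Moments after a transfer of mass to the origin *)

Section moment_mass_to_origin.
Context {R : realType} (P : {finite_measure set (measurableTypeR R) -> \bar R}).

(** The half-line splits into the origin, the interval and the rest [D]. The integrand vanishes at
    the origin because [n] is positive, the interval has become a null set, and on [D] the measure
    is still [P]. *)
Lemma moment_mass_to_origin (i : interval R) (n : nat) : (0 < n)%N ->
  [set` i] `<=` `]0, +oo[ ->
  moment (mass_to_origin P [set` i]) n =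
  (\int[P]_(y in `]0%R, +oo[ `\` [set` i]) (y ^+ n)%:E)%E.
Proof.
move=> n0 i0; pose D : set (measurableTypeR R) := `]0%R, +oo[ `\` [set` i].
have mi : measurable ([set` i] : set (measurableTypeR R)).
  exact: measurable_itv.
have m1 : measurable ([set 0] : set (measurableTypeR R)) by exact: measurable_set1.
have mD : measurable D by apply: measurableD => //; exact: measurable_itv.
rewrite /moment; have -> : [set` `[0%R, +oo[] = [set 0] `|` ([set` i] `|` D) :> set R.
  apply/seteqP; split=> [y|y]/=.
    rewrite in_itv/= andbT le_eqVlt => /predU1P[<-|y0]; [by left|right].
    have [yi|yi] := pselect ([set` i] y); first by left.
    by right; split=> //=; rewrite in_itv/= y0.
  by move=> [->|[/i0|[+ _]]]; rewrite /= !in_itv/= ?andbT// => /ltW.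
have mX E : measurable_fun E (fun y : measurableTypeR R => (y ^+ n)%:E).
  exact/measurable_funTS/measurable_EFinP/measurable_funX.
have ge0 (y : R) : ([set 0] `|` ([set` i] `|` D)) y -> (0 <= (y ^+ n)%:E)%E.
  move=> y0; rewrite lee_fin exprn_ge0//; case: y0 => [->//|[/i0|[+ _]]].
    by rewrite /= in_itv/= andbT => /ltW.
  by rewrite /= in_itv/= andbT => /ltW.
have Di : [disjoint [set` i] & D] by apply/disj_setPS => y [? []].
have D0 : [disjoint [set 0] & [set` i] `|` D].
  by apply/disj_setPS => y [/= -> [/i0|[+ _]]]; rewrite /= in_itv/= ltxx.
rewrite ge0_integral_setU//; [|exact: measurableU].
rewrite ge0_integral_setU//; last first.
  by move=> y Dy; apply: ge0; right.
rewrite [X in (X + _)%E]integral0_eq ?add0e; last first.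
  by move=> y ->; rewrite expr0n gtn_eqF.
rewrite [X in (X + _)%E](_ : _ = 0%E) ?add0e.
  apply: eq_measure_integral => A mA AD.
  rewrite /= /mass_to_origin setDidl; last first.
    by apply/seteqP; split => // y [/AD[]].
  rewrite diracE memNset ?mule0 ?adde0// => /AD[].
  by rewrite /= in_itv/= ltxx.
(* Writing 0 as an integral against the zero measure reduces the claim to a comparison of measures
   on subsets of the interval. *)
rewrite -(@integral_measure_zero _ (measurableTypeR R) R [set` i]
  (fun y => (y ^+ n)%:E)).
apply: eq_measure_integral => A mA Ai.
rewrite /= /mass_to_origin (_ : A `\` _ = set0) ?measure0 ?add0e.
  rewrite diracE memNset ?mule0// => /Ai/i0.
  by rewrite /= in_itv/= ltxx.
by rewrite setD_eq0.
Qed.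

End moment_mass_to_origin.

(** * Lognormal moments and critical ratios under transfer *)

Section lognormal_transfer.
Context {R : realType}.
Variables (alpha sigma : R).
Hypothesis sigma_gt0 : 0 < sigma.
Local Notation P := (lognormal_prob alpha sigma).
Local Notation tilted n := (lognormal_prob (alpha + n%:R * sigma ^+ 2) sigma).
Local Notation M := (lognormal_moment alpha sigma).

Lemma moment_lognormal n : moment P n = (M n)%:E.
Proof.
rewrite /moment integral_lognormal_expr//.
rewrite lognormal_prob_pos ?mule1// => y /=.
by rewrite !in_itv/= !andbT => /ltW.
Qed.

(** The exponent of [M n] is quadratic in [n], with constant second difference [sigma ^+ 2]. *)
Lemma lognormal_moment_ratio n :
  M n.+1 ^+ 2 = expR (- sigma ^+ 2) * (M n * M n.+2).
Proof.
rewrite /lognormal_moment -expRM_natl -!expRD; congr expR.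
by rewrite -[n.+2]addn2 -[n.+1]addn1 !natrD; field.
Qed.

(** The factors [1 - e n] tend to 1, so the ratios converge and their limsup is the limit. Index 0
    is left out because transferred mass does count in the moment of order 0. *)
Lemma critical_ratio_lognormal_like
    (Q : {measure set (measurableTypeR R) -> \bar R}) (e : R^nat) :
  e n @[n --> \oo] --> 0 ->
  (forall n, (0 < n)%N -> moment Q n = (M n * (1 - e n))%:E) ->
  critical_ratio Q = (expR (- sigma ^+ 2))%:E.
Proof.
move=> e0 QE; pose c := expR (- sigma ^+ 2).
pose q n := c * ((1 - e n.+1) ^+ 2 / ((1 - e n) * (1 - e n.+2))).
have cvg1 : (1 - e n) @[n --> \oo] --> (1 : R).
  by rewrite -[X in _ --> X]subr0; apply: cvgB => //; exact: cvg_cst.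
have cvg1S : (1 - e n.+1) @[n --> \oo] --> (1 : R).
  by rewrite (cvg_shiftS (fun n => 1 - e n)).
have cvg1SS : (1 - e n.+2) @[n --> \oo] --> (1 : R).
  by rewrite (cvg_shiftS (fun n => 1 - e n.+1)).
have qc : q n @[n --> \oo] --> c * (1 ^+ 2 / (1 * 1)).
  apply: cvgM; first exact: cvg_cst.
  apply: cvgM; first by rewrite /q; exact: cvgM.
  by apply: cvgV; [rewrite mulr1 oner_eq0|exact: cvgM].
rewrite expr1n mulr1 invr1 !mulr1 in qc.
rewrite /critical_ratio; suff /cvg_limn_einf_sup[_ ->//] : (moment Q n.+1 ^+ 2 /
    (moment Q n * moment Q n.+2))%E @[n --> \oo] --> c%:E.
apply: cvg_trans (_ : (q n)%:E @[n --> \oo] --> c%:E); last first.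
  by apply: cvg_EFin; [exact: nearW|exact: qc].
(* The closed form of the ratio holds only eventually: [QE] needs a positive index, and the
   denominators must be nonzero. *)
apply: near_eq_cvg; near=> n.
have n0 : (0 < n)%N by near: n; exact: nbhs_infty_gt.
have en : 0 < 1 - e n by near: n; exact: (cvgr_gt 1 cvg1).
have en2 : 0 < 1 - e n.+2 by near: n; exact: (cvgr_gt 1 cvg1SS).
have Mn := lognormal_moment_gt0 alpha sigma n.
have Mn2 := lognormal_moment_gt0 alpha sigma n.+2.
rewrite !QE// -EFin_expe -EFinM inver gt_eqF ?mulr_gt0// -EFinM; congr EFin.
rewrite /q /= exprMn lognormal_moment_ratio -/c.
by field; rewrite !gt_eqF.
Unshelve. all: by end_near. Qed.

(** * Removal of an interval close to the origin *)

Section removed_interval.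
Variables (b : R) (i : interval R).
Hypotheses (b_gt0 : 0 < b) (b_lt1 : b < 1) (ib : [set` i] `<=` `]0, b[).
Local Notation I := ([set` i] : set (measurableTypeR R)).

Let i_gt0 : [set` i] `<=` `]0, +oo[.
Proof. by move=> y /ib/=; rewrite !in_itv/= andbT => /andP[]. Qed.

Let mI : measurable I. Proof. exact: measurable_itv. Qed.

Lemma moment_lognormal_transfer n : (0 < n)%N ->
  moment (mass_to_origin P I) n = (M n * (1 - fine (tilted n I)))%:E.
Proof.
move=> n0; have m0 : measurable (`]0, +oo[%classic : set (measurableTypeR R)).
  exact: measurable_itv.
rewrite moment_mass_to_origin// integral_lognormal_expr//; last 2 first.
- exact: measurableD.
- by move=> y [/=+ _]; rewrite !in_itv/= !andbT => /ltW.
have fI : (tilted n I \is a fin_num)%E by exact: fin_num_measure.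
rewrite measureD//=; last by rewrite -ge0_fin_numE// fin_num_measure.
by rewrite setIidr// lognormal_prob_pos// EFinM EFinB fineK.
Qed.

(** The product is the integral of [y ^+ n] over [I] under [P], where [y] is at most [b] and [P] has
    mass at most 1. *)
Lemma lognormal_removed_le n :
  0 <= M n * fine (tilted n I) <= b ^+ n.
Proof.
have fI : (tilted n I \is a fin_num)%E by exact: fin_num_measure.
apply/andP; split; first by rewrite mulr_ge0 ?fine_ge0// ltW// expR_gt0.
rewrite -lee_fin EFinM fineK// -integral_lognormal_expr//; last first.
  by move=> y /i_gt0/=; rewrite !in_itv/= !andbT => /ltW.
have le0 y : I y -> 0 <= y <= b.
  by move=> /ib/=; rewrite in_itv/= => /andP[/ltW-> /ltW->].
apply: (@le_trans _ _ (\int[P]_(y in I) (cst (b ^+ n)%:E y))%E).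
  apply: ge0_le_integral => //.
  - by move=> y /le0/andP[y0 _]; rewrite lee_fin exprn_ge0.
  - exact/measurable_funTS/measurable_EFinP/measurable_funX.
  - by move=> y /le0/andP[y0 yb]; rewrite lee_fin lerXn2r// nnegrE ltW.
rewrite integral_cst// -[leRHS]mule1 lee_pmul2l ?lte_fin ?exprn_gt0//.
apply: le_trans (@sprobability_setT _ _ _ P).
by apply: le_measure; rewrite ?inE.
Qed.

Lemma critical_ratio_lognormal_transfer :
  critical_ratio (mass_to_origin P I) = (expR (- sigma ^+ 2))%:E.
Proof.
apply: (@critical_ratio_lognormal_like _ (fun n => fine (tilted n I)));
  last exact: moment_lognormal_transfer.
apply: (@squeeze_cvgr _ _ _ _ (fun=> 0) (fun n => b ^+ n)).
- near=> n; rewrite fine_ge0//=.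
  have /andP[_] := lognormal_removed_le n; apply: le_trans.
  rewrite ler_peMl ?fine_ge0// -expR0 ler_expR.
  (* This factorization shows that [M n] is at least 1 as soon as [n] exceeds
     [- (2 * alpha / sigma ^+ 2)]; a negative [alpha] can make this fail for small [n]. *)
  rewrite (_ : _ + _ = n%:R * sigma ^+ 2 / 2 * (2 * alpha / sigma ^+ 2 + n%:R)).
    apply: mulr_ge0; first by rewrite divr_ge0// mulr_ge0// sqr_ge0.
    by rewrite -lerBlDl sub0r; near: n; exact: nbhs_infty_ger.
  by field; rewrite gt_eqF.
- exact: cvg_cst.
- by apply: cvg_expr; rewrite gtr0_norm.
Unshelve. all: by end_near. Qed.

(** The distance is exactly the removed part of the moment, at most [b ^+ n], and [b ^+ n <= b]
    since [b < 1] and [n] is positive. *)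
Lemma moment_lognormal_transfer_dist n : (0 < n)%N ->
  (`|moment (mass_to_origin P I) n - moment P n| <= b%:E)%E.
Proof.
move=> n0; rewrite moment_lognormal_transfer// moment_lognormal.
rewrite -EFinB abse_EFin lee_fin.
have /andP[p0 pb] := lognormal_removed_le n.
rewrite mulrBr mulr1 addrC addKr normrN ger0_norm// (le_trans pb)//.
by rewrite -[leRHS]expr1 ler_wiXn2l// ltW.
Qed.

End removed_interval.

End lognormal_transfer.

Theorem proposition1p5 (R : realType) (alpha sigma : R) (sigma_gt0 : 0 < sigma)
    (eps : R) (eps_gt0 : 0 < eps) :
  let m := moment (lognormal_prob alpha sigma) in
  let C := critical_ratio (lognormal_prob alpha sigma) in
  exists (b0 : R) (N : nat), 0 < b0 /\
    forall b : R, 0 < b -> b < b0 ->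
      (let mt := moment (left_truncated (lognormal_prob alpha sigma) b) in
       let Ct := critical_ratio (left_truncated (lognormal_prob alpha sigma) b) in
       (forall n : nat, (N <= n)%N -> (`|mt n - m n| < eps%:E)%E) /\
       (`|Ct - C| < eps%:E)%E)
      /\
      (forall a : R, 0 < a -> a < b ->
       let mt := moment (gap_censored (lognormal_prob alpha sigma) a b) in
       let Ct := critical_ratio (gap_censored (lognormal_prob alpha sigma) a b) in
       (forall n : nat, (N <= n)%N -> (`|mt n - m n| < eps%:E)%E) /\
       (`|Ct - C| < eps%:E)%E).
Proof.
move=> m C; have CE : C = (expR (- sigma ^+ 2))%:E.
  (* The unmodified law is the case of zero error. *)
  apply: (@critical_ratio_lognormal_like _ alpha sigma _ (fun=> 0)).
    exact: cvg_cst.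
  by move=> n _; rewrite subr0 mulr1 moment_lognormal.
(* The bound 1 makes the powers of [b] decay, and the bound [eps] controls the moment distance,
   itself at most [b] from index 1 on. *)
exists (Num.min 1 eps), 1; rewrite lt_min ltr01 eps_gt0; split=> // b b0.
rewrite lt_min => /andP[b1 beps].
(* Truncation and gap-censoring are both transfers from an interval inside []0, b[], so one
   statement serves both. *)
have transfer (i : interval R) : [set` i] `<=` `]0, b[ ->
    (forall n, (1 <= n)%N ->
      (`|moment (mass_to_origin (lognormal_prob alpha sigma) [set` i]) n -
         m n| < eps%:E)%E) /\
    (`|critical_ratio (mass_to_origin (lognormal_prob alpha sigma) [set` i]) -
       C| < eps%:E)%E.
  move=> ib; split=> [n n1|].
    apply: (@le_lt_trans _ _ b%:E); last by rewrite lte_fin.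
    exact: moment_lognormal_transfer_dist ib n n1.
  rewrite (critical_ratio_lognormal_transfer _ _ _ b i)// CE.
  by rewrite -EFinB subrr abse0 lte_fin.
split=> [|a a0 ab]; first exact: (transfer `]0, b[).
apply: (transfer `]a, b[) => y /=; rewrite !in_itv/= => /andP[ay ->].
by rewrite (lt_trans a0 ay).
Qed.
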